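(* Let $M>0$, let $\mathbf{w}$ be an $M$-nice loop environment, $\lambda$ the combinatorial spectral radius of the associated matrix, and $\alpha_i,\beta_i$ ($i\in\mathbb{Z}$) as defined in the context. Then the two extremal normalized positive $\lambda$-eigenvectors $\psi^+$ (non-decreasing) and $\psi^-$ (non-increasing) are given by $$\psi^+_i=\begin{cases}\beta_{-1}\cdots\beta_i,& i<0,\\ 1,& i=0,\\ (\beta_0\beta_1\cdots\beta_{i-1})^{-1},& i>0,\end{cases}\qquad \psi^-_i=\begin{cases}(\alpha_0\alpha_{-1}\cdots\alpha_{i+1})^{-1},& i<0,\\ 1,& i=0,\\ \alpha_1\alpha_2\cdots\alpha_i,& i>0.\end{cases}$$
   Context: A loop environment is a bounded sequence $\mathbf{w}=(\mathrm{w}_i)_{i\in\mathbb{Z}}$ of non-negative reals; it is $M$-nice if $0\le\mathrm{w}_i\le M$ for all $i$, $\mathbf{w}$ is not identically $M$, and for every $\varepsilon>0$ and integer $r\ge0$ there is $i$ with $\mathrm{w}_i,\dots,\mathrm{w}_{i+r}\ge M-\varepsilon$. The associated weighted graph $\mathbb{Z}^{(\mathbf{w})}$ has adjacency matrix $A$ with $a_{i,i}=\mathrm{w}_i$, $a_{i,i\pm1}=1$, other entries $0$, and $\lambda=\limsup_n(a^{(n)}_{i,j})^{1/n}$ (entries of $A^n$). The positive solutions $\psi$ of $\psi_{k+1}+\mathrm{w}_k\psi_k+\psi_{k-1}=\lambda\psi_k$ for all $k$, normalized by $\psi_0=1$, form a convex set with exactly two extremal points, one non-decreasing ($\psi^+$)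 and one non-increasing ($\psi^-$). The weight of a path $i_0,\dots,i_n$ is $\prod_t a_{i_{t-1},i_t}$; $H^{[\ge r],\mathbf{w}}_{i,i}(z)$ (resp. $H^{[\le r],\mathbf{w}}_{i,i}(z)$) is the generating function in $z$ (by length) of the total weight of paths from $i$ to $i$ staying $\ge r$ (resp. $\le r$), and $\alpha_i=\frac1\lambda H^{[\ge i],\mathbf{w}}_{i,i}(1/\lambda)$, $\beta_i=\frac1\lambda H^{[\le i],\mathbf{w}}_{i,i}(1/\lambda)$ (these are finite positive numbers). *)

(* Defs.v *)
From HB Require Import structures.
From mathcomp Require Export all_boot all_order all_algebra.
From mathcomp Require Export all_classical all_reals all_analysis.

Set Implicit Arguments.
Unset Strict Implicit.
Unset Printing Implicit Defensive.

Import Order.TTheory GRing.Theory Num.Theory.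

Local Open Scope classical_set_scope.
Local Open Scope ring_scope.

Section LoopEnvironments.
Variable R : realType.
Implicit Types (w psi : int -> R) (i j k r : int) (s : seq int).

Definition loop_environment w : Prop :=
  (forall i, 0 <= w i) /\ (exists B : R, forall i, w i <= B).

Definition nice (M : R) w : Prop :=
  [/\ forall i, 0 <= w i <= M,
      ~ (forall i, w i = M)
    & forall (eps : R) (r : nat), 0 < eps ->
        exists i, forall k : nat, (k <= r)%N -> M - eps <= w (i + k%:Z)].

Definition adj w i j : R :=
  if j == i then w i
  else if (j == i + 1) || (j == i - 1) then 1
  else 0.

(* Entries of the n-th power of the adjacency matrix.  The sum over all of int
   is the sum over the support, which is finite because rows have at most three
   nonzero entries. *)
Fixpoint adjpow w (n : nat) i j : R :=
  if n is m.+1 then \sum_(k \in [set: int]) adj w i k * adjpow w m k j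
  else (i == j)%:R.

(* The limsup is finite for a bounded w and does not depend on i and j; the term
   of index 0 (exponent 0^-1 = 0) is irrelevant. *)
Definition spectral_radius w i j : R :=
  fine (limn_esup (fun n : nat => (adjpow w n i j `^ n%:R^-1)%:E)).

(* A path i_0, ..., i_n is represented by its origin i_0 and the sequence
   s = [:: i_1; ...; i_n]. *)
Definition path_weight w i s : R :=
  \prod_(t < size s) adj w (nth 0 (i :: s) t) (nth 0 (i :: s) t.+1).

Definition paths (P : pred int) (n : nat) i j : set (seq int) :=
  [set s | [/\ size s = n, last i s = j & all P (i :: s)]].

(* Only finitely many paths of a given length and origin have nonzero weight. *)
Definition total_weight w (P : pred int) (n : nat) i j : R :=
  \sum_(s \in paths P n i j) path_weight w i s.

Definition path_gf w (P : pred int) i j (z : R) : \bar R :=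
  (\sum_(0 <= n <oo) (total_weight w P n i j * z ^+ n)%:E)%E.

Definition H_ge w r i (z : R) : \bar R := path_gf w (fun k => r <= k) i i z.

Definition H_le w r i (z : R) : \bar R := path_gf w (fun k => k <= r) i i z.

Definition alpha w (lambda : R) i : R :=
  lambda^-1 * fine (H_ge w i i lambda^-1).

Definition beta w (lambda : R) i : R :=
  lambda^-1 * fine (H_le w i i lambda^-1).

Definition normalized_positive_eigenvectors w (lambda : R) : set (int -> R) :=
  [set psi | [/\ forall k, 0 < psi k,
                 psi 0 = 1
               & forall k, psi (k + 1) + w k * psi k + psi (k - 1)
                           = lambda * psi k]].

Definition extremal_points (S : set (int -> R)) : set (int -> R) :=
  [set psi | S psi /\
     forall (phi1 phi2 : int -> R) (t : R),
       S phi1 -> S phi2 -> 0 < t < 1 ->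
       (forall k, psi k = t * phi1 k + (1 - t) * phi2 k) ->
       phi1 = psi /\ phi2 = psi].

Definition psi_plus w (lambda : R) i : R :=
  if i < 0 then \prod_(1 <= k < `|i|%N.+1) beta w lambda (- k%:Z)
  else if i == 0 then 1
  else (\prod_(0 <= k < `|i|%N) beta w lambda k%:Z)^-1.

Definition psi_minus w (lambda : R) i : R :=
  if i < 0 then (\prod_(0 <= k < `|i|%N) alpha w lambda (- k%:Z))^-1
  else if i == 0 then 1
  else \prod_(1 <= k < `|i|%N.+1) alpha w lambda k%:Z.

End LoopEnvironments.

(* Main.v *)
Require Import Defs.
From mathcomp Require Import ring lra zify.
Import Order.TTheory GRing.Theory Num.Theory numFieldNormedType.Exports.
Local Open Scope classical_set_scope.
Local Open Scope ring_scope.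

Set Implicit Arguments.
Unset Strict Implicit.
Unset Printing Implicit Defensive.

(* For an M-nice environment the spectral radius is M + 2: row sums give the
   upper bound, and long stretches with w close to M give the lower bound. The
   eigenvector equation then reads
     psi (k + 1) - 2 psi k + psi (k - 1) = (M - w k) psi k,
   so positive solutions are convex. The generating functions of the paths to k
   staying <= k form a bounded solution on the half-line up to k, and by
   convexity a bounded solution on a half-line is unique up to scaling; this
   gives 1 / beta k + w k + beta (k - 1) = M + 2, which says that psi_plus is
   an eigenvector, and 0 < beta <= 1 makes it non-decreasing. psi_minus is its
   mirror image. Finally every normalized positive solution is
   t psi_plus + (1 - t) psi_minus, and 0 <= t <= 1 because a monotone,
   non-constant convex solution is unbounded on the side where it increases. *)

(** * Weighted walks on the line and their first-step recursion *)

Section Walks.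
Variable R : realType.
Implicit Types (w : int -> R) (P : pred int).

(** The first-step recursion gives one finite object behind both the entries of matrix powers and
    the total weights of confined paths. *)
Fixpoint walk w P (n : nat) (i j : int) : R :=
  if P i then
    if n is m.+1 then
      w i * walk w P m i j + walk w P m (i + 1) j + walk w P m (i - 1) j
    else (i == j)%:R
  else 0.

Lemma walkS w P n i j : P i ->
  walk w P n.+1 i j
  = w i * walk w P n i j + walk w P n (i + 1) j + walk w P n (i - 1) j.
Proof. by move=> Pi /=; rewrite Pi. Qed.

Lemma walk_out w P n i j : ~~ P i -> walk w P n i j = 0.
Proof. by case: n => [|n] /negbTE /= ->. Qed.

Lemma walk_ge0 w P n i j : (forall k, 0 <= w k) -> 0 <= walk w P n i j.
Proof.
move=> w0; elim: n i => [|n IH] i /=; case: (P i) => //.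
by rewrite !addr_ge0 // mulr_ge0.
Qed.

Lemma adj_self w i : adj w i i = w i.
Proof. by rewrite /adj eqxx. Qed.

Lemma adj_succ w i : adj w i (i + 1) = 1.
Proof. by rewrite /adj eqxx; case: eqP => //; lia. Qed.

Lemma adj_pred w i : adj w i (i - 1) = 1.
Proof. by rewrite /adj eqxx orbT; case: eqP => //; lia. Qed.

Lemma adj_far w i k : k \notin [:: i; i + 1; i - 1] -> adj w i k = 0.
Proof. by rewrite /adj !inE; do 3!case: eqP. Qed.

Lemma adjpow_walk w n i j : adjpow w n i j = walk w predT n i j.
Proof.
elim: n i => [//|n IH] i /=.
rewrite (fsbigE [:: i; i + 1; i - 1]) //=; first last.
- by move=> k _ /adj_far ->; rewrite mul0r.
- by rewrite !inE !negb_or; apply/andP; split => //; lia.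
rewrite !big_cons big_nil !in_setT !IH adj_self adj_succ adj_pred.
by rewrite !mul1r addr0 addrA.
Qed.

(** Only these step sequences can have non-zero weight, so the sum over all paths reduces to a
    finite one. *)
Fixpoint edge_paths (n : nat) (i : int) : seq (seq int) :=
  if n is m.+1 then
    map (cons i) (edge_paths m i)
      ++ map (cons (i + 1)) (edge_paths m (i + 1))
      ++ map (cons (i - 1)) (edge_paths m (i - 1))
  else [:: [::]].

Lemma mem_map_cons (T : eqType) (x y : T) s (S : seq (seq T)) :
  (x :: s \in map (cons y) S) = (x == y) && (s \in S).
Proof.
apply/mapP/andP => [[t tS [-> ->]] | [/eqP-> sS]]; last by exists s.
by rewrite eqxx.
Qed.

Lemma nil_map_cons (T : eqType) (y : T) (S : seq (seq T)) :
  [::] \in map (cons y) S = false.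
Proof. by apply/mapP => -[]. Qed.

Lemma edge_paths_uniq n i : uniq (edge_paths n i).
Proof.
elim: n i => [//|n IH] i /=.
rewrite !cat_uniq !map_inj_uniq ?IH /=; try by move=> s t [].
rewrite andbT; apply/andP; split; apply/hasPn => -[|x s];
  rewrite ?mem_cat ?nil_map_cons // !mem_map_cons ?inE; lia.
Qed.

Lemma path_weight_cons w i k s :
  path_weight w i (k :: s) = adj w i k * path_weight w k s.
Proof. by rewrite /path_weight /= big_ord_recl. Qed.

Lemma path_weight_far w n i s :
  size s = n -> s \notin edge_paths n i -> path_weight w i s = 0.
Proof.
elim: n i s => [|n IH] i [|k s] //= [szs].
rewrite path_weight_cons !mem_cat !mem_map_cons !negb_or.
have [nk|] := boolP (k \notin [:: i; i + 1; i - 1]).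
  by rewrite (adj_far _ nk) mul0r.
rewrite negbK !inE => kE /and3P[h0 h1 h2].
by rewrite (IH k) ?mulr0 //; case/or3P: kE h0 h1 h2 => /eqP ->;
  rewrite ?eqxx.
Qed.

Lemma size_edge_paths n i s : s \in edge_paths n i -> size s = n.
Proof.
elim: n i s => [|n IH] i s /=; first by rewrite inE => /eqP->.
by rewrite !mem_cat => /or3P[] /mapP[t /IH <- ->].
Qed.

Lemma total_weight_edge_paths w P n i j :
  total_weight w P n i j
  = \sum_(s <- edge_paths n i | (last i s == j) && all P (i :: s)) path_weight w i s.
Proof.
rewrite /total_weight.
rewrite (fsbigE [seq s <- edge_paths n i | (last i s == j) && all P (i :: s)]).
- rewrite big_filter_cond big_seq_cond [RHS]big_seq_cond.
  apply: eq_bigl => s; case: (boolP (s \in edge_paths n i)) => //= sn.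
  apply: andb_idr => /and3P[/eqP h1 h2 h3].
  by apply/mem_set; split; rewrite ?(size_edge_paths sn) //= h2.
- by rewrite filter_uniq // edge_paths_uniq.
- move=> s; rewrite /= mem_filter => /andP[/andP[/eqP h1 h2] h3].
  by split => //; rewrite (size_edge_paths h3).
- move=> s [h1 h2 h3]; rewrite mem_filter h2 eqxx h3 /=.
  exact: path_weight_far.
Qed.

Lemma total_weight_walk w P n i j : total_weight w P n i j = walk w P n i j.
Proof.
elim: n i => [|n IH] i; rewrite total_weight_edge_paths /=.
  rewrite big_cons big_nil andbT; case: (P i); rewrite ?andbF // andbT.
  by case: eqP; rewrite // /path_weight /= big_ord0 addr0.
case: (boolP (P i)) => Pi; last by rewrite big1 // => s; rewrite andbF.
rewrite !big_cat !big_map /= -!IH !total_weight_edge_paths /=.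
have E k : \sum_(s <- edge_paths n k | (last k s == j) && (P k && all P s))
      path_weight w i (k :: s)
    = adj w i k * \sum_(s <- edge_paths n k | (last k s == j) && (P k && all P s))
      path_weight w k s.
  by rewrite big_distrr /=; apply: eq_bigr => s _; rewrite path_weight_cons.
by rewrite !E adj_self adj_succ adj_pred !mul1r addrA.
Qed.

Lemma walk_reflect w r n i j :
  walk w (fun k => r <= k) n i j
  = walk (fun k => w (- k)) (fun k => k <= - r) n (- i) (- j).
Proof.
elim: n i => [|n IH] i /=; rewrite lerN2.
  by rewrite eqr_opp.
by rewrite !IH opprK !opprD !opprK -[in RHS](addrAC _ _ (walk _ _ _ _ _)).
Qed.

End Walks.

(** * The spectral radius of a nice environment *)

Section SpectralRadius.
Variable R : realType.
Implicit Types (w : int -> R).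

(** By Bernoulli's inequality [(y / x) ^+ n] eventually exceeds [C^-1]. *)
Lemma eventually_dominates (C x y : R) : 0 < C -> 0 < x < y ->
  exists N, forall n, (N <= n)%N -> x ^+ n <= C * y ^+ n.
Proof.
move=> C0 /andP[x0 xy]; set h := y / x - 1.
have h0 : 0 < h by rewrite subr_gt0 ltr_pdivlMr ?mul1r.
have bern n : 1 + n%:R * h <= (y / x) ^+ n.
  elim: n => [|n IH]; first by rewrite mul0r addr0.
  rewrite exprS (_ : y / x = 1 + h); last by rewrite /h; ring.
  rewrite (_ : y / x = 1 + h) in IH; last by rewrite /h; ring.
  have n0 : 0 <= n%:R :> R by [].
  rewrite -natr1; nra.
exists (Num.bound (C * h)^-1) => n Nn.
have Ch0 : 0 < C * h by rewrite mulr_gt0.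
have : 1 <= C * (y / x) ^+ n.
  have lt1 : (C * h)^-1 < n%:R.
    apply: lt_le_trans (archi_boundP _) _; first by rewrite invr_ge0 ltW.
    by rewrite ler_nat.
  move: lt1; rewrite -div1r ltr_pdivrMr // => lt1.
  by have := bern n; nra.
rewrite expr_div_n mulrA ler_pdivlMr ?exprn_gt0 //.
by rewrite mul1r.
Qed.

(** Constant factors disappear under n-th roots, so exponential bounds with bases up to [L]
    suffice. *)
Lemma limsup_root (u : nat -> R) (L : R) : 1 <= L ->
  (forall n, 0 <= u n <= L ^+ n) ->
  (forall mu : R, 0 < mu < L ->
     exists2 C, 0 < C & exists N, forall n, (N <= n)%N -> C * mu ^+ n <= u n) ->
  fine (limn_esup (fun n => (u n `^ n%:R^-1)%:E)) = L.
Proof.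
move=> L1 ub lb; have L0 : 0 < L by lra.
have rootK (x : R) n : 0 <= x -> (0 < n)%N -> (x ^+ n) `^ n%:R^-1 = x.
  move=> x0 n0; rewrite -powR_mulrn // -powRrM mulfV ?powRr1 //.
  by rewrite pnatr_eq0 -lt0n.
suff -> : limn_esup (fun n => (u n `^ n%:R^-1)%:E) = L%:E by [].
apply/eqP; rewrite eq_le; apply/andP; split.
  apply: le_trans (ereal_inf_lbound _) _.
    by exists setT; [exact: filterT | reflexivity].
  apply: ge_ereal_sup => _ [n _ <-]; rewrite lee_fin.
  (* The term of index 0 is 1, its exponent being 0; [1 <= L] covers it. *)
  case: (posnP n) => [->|n0]; first by rewrite invr0 powRr0.
  rewrite -[leRHS](rootK L n (ltW L0)) //.
  have /andP[? ?] := ub n.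
  by rewrite ge0_ler_powR // ?nnegrE ?invr_ge0 // exprn_ge0 // ltW.
apply: le_ereal_inf_tmp => _ [V [N _ NV] <-].
apply/lee_subgt0Pr => e e0; rewrite -EFinB.
(* [L / 2] keeps [mu] positive when [e] is large; the midpoint of [mu] and [L] leaves room to absorb
   the factor [C]. *)
pose mu := Num.max (L - e) (L / 2).
have muL : 0 < mu < L.
  rewrite /mu lt_max gt_max; apply/andP; split.
    by apply/orP; right; lra.
  by apply/andP; split; lra.
have [C C0 [N1 H1]] := lb ((mu + L) / 2) ltac:(lra).
have [N2 H2] : exists N, forall n, (N <= n)%N ->
    mu ^+ n <= C * ((mu + L) / 2) ^+ n.
  by apply: eventually_dominates => //; lra.
pose n := (N + N1 + N2).+1.
have mun : mu ^+ n <= u n.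
  apply: le_trans (H2 n _) (H1 n _); rewrite /n; lia.
apply: (@le_trans _ _ (u n `^ n%:R^-1)%:E); last first.
  by apply: ereal_sup_ubound; exists n => //; apply: NV; rewrite /= /n; lia.
rewrite lee_fin; apply: (@le_trans _ _ mu); first by rewrite le_max lexx.
have mu0 : 0 <= mu by lra.
rewrite -[leLHS](rootK mu n) //.
have /andP[? ?] := ub n.
by rewrite ge0_ler_powR // ?nnegrE ?invr_ge0 // exprn_ge0.
Qed.

Section Bounds.
Variables (M : R) (w : int -> R) (q : int).
Hypothesis M_gt0 : 0 < M.
Hypothesis w_bnd : forall i, 0 <= w i <= M.
Let a n i := walk w predT n i q.

Let w_ge0 i : 0 <= w i.
Proof. by have /andP[] := w_bnd i. Qed.

Lemma walk_le n i : a n i <= (M + 2) ^+ n.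
Proof.
elim: n i => [|n IH] i; first by rewrite /a /= expr0; case: eqP.
rewrite /a walkS // exprS -/(a n i) -/(a n (i + 1)) -/(a n (i - 1)).
have /andP[w0 wM] := w_bnd i.
have := IH i; have := IH (i + 1); have := IH (i - 1).
have X0 : 0 <= (M + 2) ^+ n by rewrite exprn_ge0 //; lra.
nra.
Qed.

Let a_ge0 n i : 0 <= a n i. Proof. exact: walk_ge0. Qed.

(** Go straight from [i] to [j] in [d] steps of weight 1, then continue to [q]. *)
Lemma walk_shift d n i j : `|i - j|%N = d -> a n j <= a (n + d) i.
Proof.
elim: d i => [|d IH] i dE.
  by rewrite addn0 (_ : i = j) //; lia.
rewrite addnS /a walkS // -!/(a _ _).
have := a_ge0 (n + d) (i + 1); have := a_ge0 (n + d) (i - 1).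
have := mulr_ge0 (w_ge0 i) (a_ge0 (n + d) i).
have [ij|ij] := leP i j.
  by have := IH (i + 1) ltac:(lia); lra.
by have := IH (i - 1) ltac:(lia); lra.
Qed.

(* The quadratic profile [k (L - k)] has second difference [-2], which is a
   small fraction of its values when [L] is large; it is thus almost an
   eigenvector for [M + 2] on a stretch where [w] is close to [M]. *)
Lemma walk_growth p (mu : R) :
  (forall (eps : R) (r : nat), 0 < eps ->
     exists i, forall k : nat, (k <= r)%N -> M - eps <= w (i + k%:Z)) ->
  0 < mu < M + 2 ->
  exists2 C, 0 < C & exists N, forall n, (N <= n)%N -> C * mu ^+ n <= a n p.
Proof.
move=> w_stretch /andP[mu0 muM].
pose delta := M + 2 - mu.
(* [delta / 2] leaves half of the gap for the profile; [M / 2] keeps [w] away from 0 on the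
   stretch. *)
pose eps := Num.min (delta / 2) (M / 2).
have d0 : 0 < delta by rewrite /delta subr_gt0.
have eps0 : 0 < eps by rewrite /eps lt_min !divr_gt0.
have epsd : eps <= delta / 2 by rewrite /eps ge_min lexx.
have epsM : eps <= M / 2 by rewrite /eps ge_min lexx orbT.
(* With [L = l.+2], the least interior value of [k (L - k)] is [l.+1]; the spare factor [delta / 2]
   then compensates the second difference -2. *)
have [l lE] : exists l : nat, 2 <= delta / 2 * l.+1%:R.
  exists (Num.bound (4 / delta)).
  have /archi_boundP : 0 <= 4 / delta by rewrite divr_ge0 // ltW.
  by rewrite ltr_pdivrMr // -natr1 => ?; nra.
pose L := l.+2.
have [i wi] := w_stretch eps L eps0.
pose m := Num.min 1 (M / 2).
have m0 : 0 < m by rewrite lt_min; apply/andP; split; lra.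
have m1 : m <= 1 by rewrite ge_min lexx.
have mw k : (k <= L)%N -> m <= w (i + k%:Z).
  move=> kL; have := wi k kL; have : m <= M / 2 by rewrite ge_min lexx orbT.
  by move=> *; lra.
(* Every point of the stretch is within [n0] of [q], and loops of weight at least [m] use up the
   spare time. *)
pose n0 := (`|i - q| + L)%N.
have start n k : (k <= L)%N -> (`|(i + k%:Z - q)%R|%N <= n)%N -> m ^+ n <= a n (i + k%:Z).
  move=> kL; elim: n => [|n IH] dn.
    by rewrite expr0 /a /= (_ : i + k%:Z = q) ?eqxx //; lia.
  have [dn'|dn'] := leqP `|(i + k%:Z - q)%R|%N n.
    rewrite /a walkS // exprS -!/(a _ _).
    have := a_ge0 n (i + k%:Z + 1); have := a_ge0 n (i + k%:Z - 1).
    have := IH dn'; have := mw k kL; have : 0 <= m ^+ n by rewrite exprn_ge0 // ltW.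
    by move=> *; nra.
  have : a 0 q <= a (0 + n.+1) (i + k%:Z) by apply: walk_shift; lia.
  rewrite add0n {1}/a /= eqxx; apply: le_trans.
  by rewrite exprn_ile1 // ltW.
pose v (k : nat) : R := (k * (L - k))%:R.
have [c c0 cv] : exists2 c, 0 < c & forall k, (k <= L)%N -> c * v k <= m ^+ n0.
  exists (m ^+ n0 / (L * L)%:R) => [|k kL].
    by rewrite divr_gt0 ?exprn_gt0 // ltr0n.
  rewrite mulrAC ler_pdivrMr ?ltr0n // ler_wpM2l ?exprn_ge0 ?(ltW m0) //.
  by rewrite ler_nat leq_mul // leq_subr.
have grow n k : (k <= L)%N -> c * mu ^+ n * v k <= a (n0 + n) (i + k%:Z).
  elim: n k => [|n IH] k kL.
    rewrite addn0 expr0 mulr1; apply: le_trans (cv k kL) _.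
    by apply: start => //; rewrite /n0; lia.
  have [kE|/andP[k0 kL']] : (k = 0%N \/ k = L) \/ (0 < k < L)%N by lia.
    by rewrite (_ : v k = 0) ?mulr0 // /v (_ : (k * _)%N = 0%N) //; case: kE => ->;
      rewrite ?subnn ?muln0.
  rewrite addnS /a walkS // -!/(a _ _).
  have h1 : i + k%:Z + 1 = i + (k.+1)%:Z by lia.
  have h2 : i + k%:Z - 1 = i + (k.-1)%:Z by lia.
  have := IH k kL; have := IH k.+1 kL'; have := IH k.-1 ltac:(lia).
  rewrite -h1 -h2.
  have vE : v k.+1 + v k.-1 = 2 * v k - 2.
    have vR j : (j <= L)%N -> v j = j%:R * (L%:R - j%:R).
      by move=> jL; rewrite /v natrM natrB.
    rewrite !vR; try lia.
    by case: k k0 {kL kL' h1 h2 vR} => // j _; rewrite /= -!natr1; ring.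
  have vl : l.+1%:R <= v k by rewrite /v ler_nat /L in kL' *; nia.
  have wk := wi k kL.
  have cm0 : 0 <= c * mu ^+ n by rewrite mulr_ge0 ?exprn_ge0 // ltW.
  rewrite exprS; set X := c * mu ^+ n in cm0 *.
  have -> : c * (mu * mu ^+ n) = mu * X by rewrite /X; ring.
  have v0 : 0 <= v k by rewrite /v.
  (* Together with [vE] this says that one step of the walk multiplies the profile by at least
     [mu]. *)
  have key : 2 <= (w (i + k%:Z) + 2 - mu) * v k.
    apply: le_trans lE _; apply: ler_pM => //; try lra.
    by rewrite /delta in epsd *; lra.
  have /(ler_wpM2l cm0) := key.
  have /(congr1 (fun x => X * x)) := vE.
  have := w_ge0 (i + k%:Z).
  move=> w0 e1 e2 e3 e4 e5.
  have := ler_wpM2l w0 e5.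
  by move=> e6; lra.
(* The profile vanishes at [i], so the walk from [p] is led to [i + 1] instead, at the cost of [d]
   steps. *)
pose d := `|(p - (i + 1))%R|%N.
exists (c * v 1%N / mu ^+ (n0 + d)).
  by rewrite divr_gt0 ?exprn_gt0 // mulr_gt0 // /v ltr0n mul1n /L.
exists (n0 + d)%N => n nN.
have [n' ->] : exists n', n = (n0 + n' + d)%N by exists (n - (n0 + d))%N; lia.
apply: le_trans (walk_shift _ (j := i + 1) _); last by [].
apply: le_trans (grow n' 1%N _); last by [].
rewrite (_ : (n0 + n' + d = (n0 + d) + n')%N); last by lia.
rewrite [mu ^+ (_ + n')]exprD mulrA divfK ?expf_neq0 ?gt_eqF //.
by rewrite mulrAC.
Qed.

End Bounds.

Lemma nice_spectral_radius (M : R) w p q : 0 < M -> nice M w ->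
  spectral_radius w p q = M + 2.
Proof.
move=> M0 [wM _ wS]; rewrite /spectral_radius.
under eq_fun do rewrite adjpow_walk.
apply: (limsup_root (u := fun n => walk w predT n p q)); first by lra.
  move=> n; rewrite walk_le // andbT walk_ge0 // => k.
  by have /andP[] := wM k.
by move=> mu; exact: (walk_growth _ M0 wM).
Qed.

End SpectralRadius.

(** * Half-line generating functions and the non-decreasing eigenvector *)

Section Hitting.
Variables (R : realType) (M : R) (w : int -> R).
Hypothesis M_gt0 : 0 < M.
Hypothesis w_bnd : forall i, 0 <= w i <= M.
Let lam : R := M + 2.

Let w_ge0 i : 0 <= w i.
Proof. by have /andP[] := w_bnd i. Qed.

Let lam_gt0 : 0 < lam. Proof. by rewrite addr_gt0. Qed.

Let lam_neq0 : lam != 0. Proof. by rewrite gt_eqF. Qed.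

(** Truncation postpones convergence questions; the factor [lam^-1] is the normalization of
    [beta]. *)
Definition green (k : int) (N : nat) (i : int) : R :=
  lam^-1 * \sum_(0 <= n < N) walk w (fun x => x <= k) n i k * lam^-1 ^+ n.

(* Given the value 1 at [k + 1], [hit k] becomes the bounded eigenvector on the
   half-line ending at [k + 1]. *)
Definition hit (k i : int) : R := limn (fun N => green k N i).

Lemma green_out k N i : k < i -> green k N i = 0.
Proof.
move=> ki; rewrite /green big1 ?mulr0 // => n _.
by rewrite walk_out ?mul0r // -ltNge.
Qed.

Lemma greenS k N i : i <= k ->
  lam * green k N.+1 i
  = (i == k)%:R + w i * green k N i + green k N (i + 1) + green k N (i - 1).
Proof.
move=> ik; rewrite /green mulVKf // big_nat_recl //= ik expr0 mulr1 -!addrA.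
congr (_ + _); rewrite !mulr_sumr -!big_split /=; apply: eq_bigr => n _.
by rewrite exprS; ring.
Qed.

Lemma green_ge0 k N i : 0 <= green k N i.
Proof.
rewrite /green mulr_ge0 ?invr_ge0 ?(ltW lam_gt0) // sumr_ge0 // => n _.
by rewrite mulr_ge0 ?walk_ge0 // exprn_ge0 // invr_ge0 ltW.
Qed.

(** The constant 1 is a supersolution, because [w i + 2 <= lam]; induction on the truncation. *)
Lemma green_le1 k N i : green k N i <= 1.
Proof.
elim: N i => [|N IH] i; first by rewrite /green big_nil mulr0.
have [ik|ki] := leP i k; last by rewrite green_out.
rewrite -(ler_pM2l lam_gt0) mulr1 greenS //.
have /andP[w0 wM] := w_bnd i.
have h1 : w i * green k N i <= M.
  by apply: le_trans wM; rewrite ler_piMr ?IH.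
(* At [i = k] the source term takes the place of the right neighbour, whose value is 0. *)
have h2 : (i == k)%:R + green k N (i + 1) <= 1.
  case: eqP => [->|_]; last by rewrite add0r.
  by rewrite green_out ?addr0 //; lia.
by have := IH (i - 1); rewrite /lam; lra.
Qed.

Lemma green_nd k i : nondecreasing_seq (fun N => green k N i).
Proof.
apply/nondecreasing_seqP => N; rewrite /green ler_pM2l ?invr_gt0 //.
rewrite big_nat_recr //= lerDl mulr_ge0 ?walk_ge0 // exprn_ge0 //.
by rewrite invr_ge0 ltW.
Qed.

Lemma cvg_green k i : green k N i @[N --> \oo] --> hit k i.
Proof.
apply: nondecreasing_is_cvgn (green_nd k i) _.
by exists 1 => _ [N _ <-]; exact: green_le1.
Qed.

Lemma hit_ge0 k i : 0 <= hit k i.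
Proof.
apply: limr_ge; first exact: cvg_green.
by apply: nearW => N; exact: green_ge0.
Qed.

Lemma hit_le1 k i : hit k i <= 1.
Proof.
apply: limr_le; first exact: cvg_green.
by apply: nearW => N; exact: green_le1.
Qed.

Lemma hit_out k i : k < i -> hit k i = 0.
Proof.
move=> ki; apply/eqP; rewrite eq_le hit_ge0 andbT.
apply: limr_le; first exact: cvg_green.
by apply: nearW => N; rewrite green_out.
Qed.

Lemma hit_eq k i : i <= k ->
  lam * hit k i = (i == k)%:R + w i * hit k i + hit k (i + 1) + hit k (i - 1).
Proof.
move=> ik.
have L : lam * green k N.+1 i @[N --> \oo] --> lam * hit k i.
  apply: cvgMr; rewrite (cvg_shiftS (fun N => green k N i)).
  exact: cvg_green.
have L' : lam * green k N.+1 i @[N --> \oo] -->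
    (i == k)%:R + w i * hit k i + hit k (i + 1) + hit k (i - 1).
  under eq_cvg do rewrite (greenS _ ik).
  apply: cvgD; last exact: cvg_green.
  apply: cvgD; last exact: cvg_green.
  by apply: cvgD; [exact: cvg_cst | apply: cvgMr; exact: cvg_green].
exact: cvg_unique L L'.
Qed.

(** The partial sums converge in the reals, so the extended series is finite and [fine] loses
    nothing. *)
Lemma beta_hit k : beta w lam k = hit k k.
Proof.
rewrite /beta /H_le /path_gf.
under eq_eseriesr do rewrite total_weight_walk.
pose S N := \sum_(0 <= n < N) walk w (fun x => x <= k) n k k * lam^-1 ^+ n.
have SE N : S N = lam * green k N k by rewrite /green mulVKf.
have Scvg : S N @[N --> \oo] --> lam * hit k k.
  by under eq_cvg do rewrite SE; apply: cvgMr; exact: cvg_green.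
have -> : (fun N => \sum_(0 <= n < N)
    (walk w (fun x => x <= k) n k k * lam^-1 ^+ n)%:E)%E = EFin \o S.
  by apply/funext => N; rewrite sumEFin.
rewrite EFin_lim; last by apply/cvg_ex; exists (lam * hit k k).
by rewrite (cvg_lim _ Scvg) //= mulKf.
Qed.

(* A non-zero solution vanishing at [k + 1] is convex and so grows at least
   linearly to the left of [k]. *)
Lemma bounded_solution_zero (k : int) (d : int -> R) (B : R) :
  (forall i, i <= k -> lam * d i = w i * d i + d (i + 1) + d (i - 1)) ->
  (forall i, `|d i| <= B) -> d (k + 1) = 0 -> d k = 0.
Proof.
wlog dk : d / 0 <= d k.
  move=> H dE dB d0; have [|lt0] := leP 0 (d k); first by move=> ?; exact: H dB d0.
  apply: oppr_inj; rewrite oppr0; apply: (H (fun i => - d i)) => [|i ik|i|].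
  - by rewrite oppr_ge0 ltW.
  - by have := dE i ik; lra.
  - by rewrite normrN.
  - by rewrite d0 oppr0.
move=> dE dB d0; apply/eqP; rewrite eq_le dk andbT leNgt; apply/negP => dpos.
(* Convexity keeps each leftward increment at least as large as the first,
   [d k - d (k + 1) = d k]. *)
have grow (n : nat) : n.+1%:R * d k <= d (k - n%:Z)
    /\ d k <= d (k - n%:Z) - d (k - n%:Z + 1).
  elim: n => [|n [IH1 IH2]].
    by rewrite subr0 mul1r d0 subr0.
  have := dE (k - n%:Z) ltac:(lia).
  rewrite (_ : k - n%:Z - 1 = k - n.+1%:Z); last by lia.
  rewrite (_ : k - n.+1%:Z + 1 = k - n%:Z); last by lia.
  have /andP[w0 wM] := w_bnd (k - n%:Z).
  have : 0 <= (M - w (k - n%:Z)) * d (k - n%:Z).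
    rewrite mulr_ge0 ?subr_ge0 //; apply: le_trans IH1.
    by rewrite mulr_ge0.
  rewrite /lam -[n.+2%:R]natr1 => h1 h2; split; nra.
have := grow (Num.bound (B / d k)); case=> + _.
have B0 : 0 <= B by apply: le_trans (dB 0).
have /archi_boundP : 0 <= B / d k by rewrite divr_ge0.
rewrite ltr_pdivrMr //; set n := Num.bound _ => h1.
have := dB (k - n%:Z); have := ler_norm (d (k - n%:Z)).
by rewrite -natr1; nra.
Qed.

(** As functions of the starting point, [hit k] and [hit k k] times [hit (k - 1)], the latter
    extended by 1 at [k], are bounded solutions up to [k - 1] that agree at [k]; uniqueness
    identifies them. *)
Lemma hit_pred k : hit k (k - 1) = hit k k * hit (k - 1) (k - 1).
Proof.
(* [(i == k)%:R] supplies the boundary value 1, since [hit (k - 1)] is 0 at [k]. *)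
pose d i := hit k i - hit k k * (hit (k - 1) i + (i == k)%:R).
have kE : k - 1 + 1 = k by lia.
suff : d (k - 1) = 0.
  rewrite /d; case: eqP => [|_]; first by lia.
  by rewrite addr0 => /eqP; rewrite subr_eq0 => /eqP.
apply: (@bounded_solution_zero _ _ 3).
- move=> i ik; have := @hit_eq k i ltac:(lia); have := hit_eq ik; rewrite /d.
  have -> : (i == k) = false by lia.
  have -> : (i - 1 == k) = false by lia.
  have -> : (i + 1 == k) = (i == k - 1) by lia.
  by move=> /(congr1 (fun x => hit k k * x)) /=; lra.
- move=> i; rewrite /d.
  have h1 := hit_ge0 k i; have h2 := hit_le1 k i.
  have h3 := hit_ge0 k k; have h4 := hit_le1 k k.
  have h5 := hit_ge0 (k - 1) i; have h6 := hit_le1 (k - 1) i.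
  have [b -> /andP[h7 h8]] : exists2 b : R, (i == k)%:R = b & 0 <= b <= 1.
    by exists (i == k)%:R => //; case: eqP => _; rewrite ?lexx ler01.
  have h9 := mulr_ge0 h3 (addr_ge0 h5 h7).
  have h10 := ler_wpM2l h3 (lerD h6 h8).
  by rewrite ler_norml; apply/andP; split; lra.
- by rewrite /d kE eqxx [hit (k - 1) k]hit_out ?add0r ?mulr1 ?subrr //; lia.
Qed.

(** This is the equation of [hit k] at [k]: the right neighbour contributes 0 and [hit_pred] factors
    the left one. *)
Lemma beta_rec k :
  lam * beta w lam k
  = 1 + w k * beta w lam k + beta w lam k * beta w lam (k - 1).
Proof.
rewrite !beta_hit -hit_pred hit_eq // eqxx [hit k (k + 1)]hit_out ?addr0 //.
by lia.
Qed.

Lemma beta_gt0 k : 0 < beta w lam k.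
Proof.
rewrite lt_neqAle eq_sym beta_hit hit_ge0 andbT -beta_hit; apply/eqP => b0.
by have := beta_rec k; rewrite b0 !mulr0 mul0r !addr0 => /eqP; rewrite eq_sym oner_eq0.
Qed.

Lemma beta_le1 k : beta w lam k <= 1.
Proof. by rewrite beta_hit; exact: hit_le1. Qed.

(** One recurrence covers the three cases of the definition; it makes the eigenvector equation at
    [k] the multiple of [beta_rec] by [psi_plus] at [k + 1]. *)
Lemma psi_plus_pred i :
  psi_plus w lam i = beta w lam i * psi_plus w lam (i + 1).
Proof.
rewrite /psi_plus.
case: i => [n|n].
  have -> : (n%:Z + 1 < 0) = false by lia.
  have -> : (n%:Z < 0) = false by lia.
  have -> : (n%:Z + 1 == 0) = false by lia.
  rewrite (_ : `|(n%:Z + 1)%R|%N = n.+1); last by lia.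
  have b0 : beta w lam n != 0 by rewrite gt_eqF ?beta_gt0.
  rewrite big_nat_recr //= invfM mulrCA mulfV // mulr1.
  by case: (n) => [|?] /=; [rewrite big_geq ?invr1 | reflexivity].
rewrite NegzE.
have -> : (- n.+1%:Z < 0) by lia.
rewrite (_ : `|(- n.+1%:Z)%R|%N = n.+1); last by lia.
rewrite big_nat_recr //= mulrC; congr (_ * _).
case: n => [|n]; first by rewrite big_geq.
have -> : - n.+2%:Z + 1 = - n.+1%:Z by lia.
have -> : (- n.+1%:Z < 0) by lia.
by rewrite (_ : `|(- n.+1%:Z)%R|%N = n.+1); last by lia.
Qed.

Lemma psi_plus_gt0 i : 0 < psi_plus w lam i.
Proof.
rewrite /psi_plus; case: ifP => _; first by apply: prodr_gt0 => k _; exact: beta_gt0.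
case: ifP => // _.
by rewrite invr_gt0; apply: prodr_gt0 => k _; exact: beta_gt0.
Qed.

Lemma psi_plus_eigenvector :
  normalized_positive_eigenvectors w lam (psi_plus w lam).
Proof.
split=> [k||k]; [exact: psi_plus_gt0 | by rewrite /psi_plus ltxx eqxx |].
have kE : k - 1 + 1 = k by lia.
rewrite (psi_plus_pred (k - 1)) kE (psi_plus_pred k).
have := congr1 (fun x => x * psi_plus w lam (k + 1)) (beta_rec k).
by move=> /= E; rewrite [RHS]mulrA E; ring.
Qed.

Lemma psi_plus_homo i j : i <= j -> psi_plus w lam i <= psi_plus w lam j.
Proof.
move=> ij; have [n ->] : exists n : nat, j = i + n%:Z by exists `|(j - i)%R|%N; lia.
elim: n => [|n IH]; first by rewrite addr0.
apply: le_trans IH _; rewrite psi_plus_pred.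
rewrite (_ : i + n%:Z + 1 = i + n.+1%:Z); last by lia.
by rewrite ger_pMl ?beta_le1 // psi_plus_gt0.
Qed.

End Hitting.

(** * Reflection of the line *)

Section Reflection.
Variable R : realType.
Implicit Types (w psi : int -> R) (lam : R).

Lemma alpha_reflect w lam i :
  alpha w lam i = beta (fun k => w (- k)) lam (- i).
Proof.
rewrite /alpha /beta /H_ge /H_le /path_gf.
under eq_eseriesr do rewrite total_weight_walk walk_reflect.
by under [in RHS]eq_eseriesr do rewrite total_weight_walk.
Qed.

(** Reflection exchanges [alpha] and [beta], so facts about [psi_plus] transfer to [psi_minus] with
    monotonicity reversed. *)
Lemma psi_minus_reflect w lam i :
  psi_minus w lam i = psi_plus (fun k => w (- k)) lam (- i).
Proof.
have alphaN k : alpha w lam (- k) = beta (fun x => w (- x)) lam k.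
  by rewrite alpha_reflect opprK.
rewrite /psi_minus /psi_plus oppr_eq0 abszN.
case: (ltgtP i 0) => [i0|i0|->]; rewrite ?oppr0 ?ltxx //.
- have -> : (- i < 0) = false by lia.
  by congr (_^-1); apply: eq_bigr => k _; exact: alphaN.
- have -> : - i < 0 by lia.
  by apply: eq_bigr => k _; exact: alpha_reflect.
Qed.

Lemma eigenvector_reflect w lam psi :
  normalized_positive_eigenvectors w lam psi ->
  normalized_positive_eigenvectors
    (fun k => w (- k)) lam (fun k => psi (- k)).
Proof.
case=> pos norm eigen; split=> [k||k]; rewrite ?oppr0 //.
by rewrite -eigen !opprD opprK; ring.
Qed.

End Reflection.

(** * Convex coordinates and extremal points *)

Section Extremal.
Variable R : realType.
Implicit Types (M : R) (w psi pp pm : int -> R).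

(** A second-order recurrence propagates two consecutive zeros in both directions. *)
Lemma eigenvector_determined w (lam : R) (d : int -> R) :
  (forall k, d (k + 1) + w k * d k + d (k - 1) = lam * d k) ->
  d 0 = 0 -> d 1 = 0 -> forall k, d k = 0.
Proof.
move=> dE d0 d1.
have pos (n : nat) : d n%:Z = 0 /\ d n.+1%:Z = 0.
  elim: n => [//|n [h1 h2]]; split=> //.
  have := dE n.+1%:Z; rewrite h2.
  have -> : n.+1%:Z - 1 = n%:Z by lia.
  have -> : n.+1%:Z + 1 = n.+2%:Z by lia.
  by rewrite h1; lra.
have neg (n : nat) : d (- n%:Z) = 0 /\ d (1 - n%:Z) = 0.
  elim: n => [|n [h1 h2]]; first by rewrite oppr0 subr0.
  have := dE (- n%:Z); rewrite h1.
  have -> : - n%:Z - 1 = - n.+1%:Z by lia.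
  have -> : - n%:Z + 1 = 1 - n%:Z by lia.
  have -> : 1 - n.+1%:Z = - n%:Z by lia.
  by rewrite h1 h2; split; lra.
by case=> n; [have [] := pos n | rewrite NegzE; have [] := neg n.+1].
Qed.

(** A positive constant solution would force [2 + w i = M + 2] for all [i]. *)
Lemma eigenvector_not_constant M w psi : ~ (forall i, w i = M) ->
  normalized_positive_eigenvectors w (M + 2) psi ->
  ~ (forall i, psi (i + 1) = psi i).
Proof.
move=> wM [pos _ eigen] cst; apply: wM => i.
have := eigen i; rewrite cst.
have -> : psi (i - 1) = psi i by rewrite -(cst (i - 1)); congr psi; lia.
by have := pos i => p0 E; apply: (mulIf (lt0r_neq0 p0)); lra.
Qed.

(** Some increment is positive, and by convexity later increments are no smaller, so growth is at
    least linear. *)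
Lemma increasing_eigenvector_unbounded M w psi :
  (forall i, 0 <= w i <= M) -> ~ (forall i, w i = M) ->
  normalized_positive_eigenvectors w (M + 2) psi ->
  (forall i j, i <= j -> psi i <= psi j) ->
  forall B : R, exists2 i, 0 <= i & B < psi i.
Proof.
move=> w_bnd wM psiE homo B; have [pos _ eigen] := psiE.
have [i di] : exists i, psi i < psi (i + 1).
  apply: contrapT => /forallNP H; apply: (eigenvector_not_constant wM psiE) => i.
  apply/eqP; rewrite eq_le leNgt; apply/andP; split; first exact/negP.
  by apply: homo; rewrite lerDl.
set e := psi (i + 1) - psi i.
have e0 : 0 < e by rewrite subr_gt0.
have grow (n : nat) : e <= psi (i + n%:Z + 1) - psi (i + n%:Z)
    /\ n%:R * e <= psi (i + n%:Z).
  elim: n => [|n [IH1 IH2]].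
    by rewrite addr0 mul0r lexx; split => //; exact: ltW.
  have := eigen (i + n.+1%:Z).
  have -> : i + n.+1%:Z - 1 = i + n%:Z by lia.
  rewrite (_ : i + n%:Z + 1 = i + n.+1%:Z) in IH1; last by lia.
  have := pos (i + n.+1%:Z); have /andP[? wm] := w_bnd (i + n.+1%:Z) => p0 E.
  have : 0 <= (M - w (i + n.+1%:Z)) * psi (i + n.+1%:Z).
    by rewrite mulr_ge0 ?subr_ge0 // ltW.
  by rewrite -natr1 => ?; split; lra.
(* Adding the absolute value of [i] makes [i + n] non-negative. *)
pose n := (Num.bound (`|B| / e) + `|i|)%N.
exists (i + n%:Z); first by rewrite /n; lia.
have [_] := grow n; apply: lt_le_trans.
have h : `|B| / e < n%:R.
  have : `|B| / e < (Num.bound (`|B| / e))%:R.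
    by apply: archi_boundP; rewrite divr_ge0 // ltW.
  by move=> /lt_le_trans; apply; rewrite ler_nat leq_addr.
by rewrite ltr_pdivrMr // in h; apply: le_lt_trans (ler_norm B) h.
Qed.

Section Pair.
Variables (M : R) (w pp pm : int -> R).
Hypothesis w_bnd : forall i, 0 <= w i <= M.
Hypothesis wM : ~ (forall i, w i = M).
Hypothesis ppE : normalized_positive_eigenvectors w (M + 2) pp.
Hypothesis pmE : normalized_positive_eigenvectors w (M + 2) pm.
Hypothesis pp_homo : forall i j, i <= j -> pp i <= pp j.
Hypothesis pm_homo : forall i j, i <= j -> pm j <= pm i.

(** If [t < 0], then far to the right [t * pp] outweighs [(1 - t) * pm], which is at most [1 - t]
    there, against positivity. *)
Lemma coefficient_ge0 (t : R) :
  (forall k, 0 < t * pp k + (1 - t) * pm k) -> 0 <= t.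
Proof.
move=> pos; rewrite leNgt; apply/negP => t0.
have [i i0 Hi] := increasing_eigenvector_unbounded w_bnd wM ppE pp_homo
  ((1 - t) / - t).
move: Hi; rewrite ltr_pdivrMr; last by rewrite oppr_gt0.
have pm1 : pm i <= 1 by have [_ <- _] := pmE; exact: pm_homo.
by have := pos i => *; nra.
Qed.

(** Agreement at 0 and 1 would make the two solutions equal, hence both non-decreasing and
    non-increasing, hence constant. *)
Lemma monotone_pair_neq : pp 1 != pm 1.
Proof.
apply/eqP => E1; have [_ pp0 pp_eq] := ppE; have [_ pm0 pm_eq] := pmE.
have D k : pp k = pm k.
  apply/eqP; rewrite -subr_eq0; apply/eqP.
  apply: (@eigenvector_determined w (M + 2) (fun k => pp k - pm k)).
  - by move=> j; have := pp_eq j; have := pm_eq j; lra.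
  - by rewrite pp0 pm0 subrr.
  - by rewrite E1 subrr.
apply: (eigenvector_not_constant wM ppE) => i; apply/eqP.
by rewrite eq_le {1}D (D i) pm_homo -?D ?pp_homo // lerDl.
Qed.

(** [t] is fitted at 1, all solutions agree at 0, and these two values determine a solution. *)
Lemma affine_coordinate psi :
  normalized_positive_eigenvectors w (M + 2) psi ->
  exists t : R, forall k, psi k = t * pp k + (1 - t) * pm k.
Proof.
move=> [_ psi0 psi_eq]; have [_ pp0 pp_eq] := ppE; have [_ pm0 pm_eq] := pmE.
have D : pp 1 - pm 1 != 0 by rewrite subr_eq0 monotone_pair_neq.
pose t := (psi 1 - pm 1) / (pp 1 - pm 1); exists t => k.
apply/eqP; rewrite -subr_eq0; apply/eqP.
apply: (@eigenvector_determined w (M + 2)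
  (fun k => psi k - (t * pp k + (1 - t) * pm k))).
- move=> j; have := psi_eq j.
  have := congr1 (fun x => t * x) (pp_eq j).
  by have := congr1 (fun x => (1 - t) * x) (pm_eq j); rewrite /=; lra.
- by rewrite psi0 pp0 pm0; ring.
- have : t * (pp 1 - pm 1) = psi 1 - pm 1 by rewrite /t divfK.
  by lra.
Qed.

End Pair.

Lemma convex_coordinate M w pp pm psi :
  (forall i, 0 <= w i <= M) -> ~ (forall i, w i = M) ->
  normalized_positive_eigenvectors w (M + 2) pp ->
  normalized_positive_eigenvectors w (M + 2) pm ->
  (forall i j, i <= j -> pp i <= pp j) ->
  (forall i j, i <= j -> pm j <= pm i) ->
  normalized_positive_eigenvectors w (M + 2) psi ->
  exists2 t : R, 0 <= t <= 1 & forall k, psi k = t * pp k + (1 - t) * pm k.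
Proof.
move=> w_bnd wM ppE pmE pp_homo pm_homo psiE.
have [t tE] := affine_coordinate wM ppE pmE pp_homo pm_homo psiE.
have [pos _ _] := psiE.
exists t => //; apply/andP; split.
  apply: (coefficient_ge0 w_bnd wM ppE pmE pp_homo pm_homo) => k.
  by rewrite -tE.
rewrite -subr_ge0.
(* After reflection [pp] and [pm] swap roles and the coefficient in question becomes [1 - t]. *)
apply: (@coefficient_ge0 M (fun k => w (- k))
  (fun k => pm (- k)) (fun k => pp (- k))).
- by move=> i; exact: w_bnd.
- by move=> H; apply: wM => i; rewrite -(H (- i)) opprK.
- exact: eigenvector_reflect.
- exact: eigenvector_reflect.
- by move=> i j ij; apply: pm_homo; rewrite lerN2.
- by move=> i j ij; apply: pp_homo; rewrite lerN2.
- by move=> k; have := pos (- k); rewrite tE; lra.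
Qed.

(** All eigenvectors lie on the segment from [pm] to [pp]; the coordinate is read off at 1, where
    these two differ. *)
Lemma extremal_points_monotone M w pp pm :
  (forall i, 0 <= w i <= M) -> ~ (forall i, w i = M) ->
  normalized_positive_eigenvectors w (M + 2) pp ->
  normalized_positive_eigenvectors w (M + 2) pm ->
  (forall i j, i <= j -> pp i <= pp j) ->
  (forall i j, i <= j -> pm j <= pm i) ->
  extremal_points (normalized_positive_eigenvectors w (M + 2)) = [set pp; pm].
Proof.
move=> w_bnd wM ppE pmE pp_homo pm_homo.
have neq := monotone_pair_neq wM ppE pmE pp_homo pm_homo.
have coord := convex_coordinate w_bnd wM ppE pmE pp_homo pm_homo.
have D : pp 1 - pm 1 != 0 by rewrite subr_eq0.
apply/seteqP; split=> psi.
  case=> psiE ext; have [t /andP[t0 t1] tE] := coord psi psiE.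
  have [tE0|tn0] := eqVneq t 0.
    by right; apply/funext => k; rewrite tE tE0; lra.
  have [tE1|tn1] := eqVneq t 1.
    by left; apply/funext => k; rewrite tE tE1; lra.
  (* Strictly inside the segment, extremality would force [pp] and [pm] both to equal [psi]. *)
  have t01 : 0 < t < 1 by rewrite !lt_neqAle t0 t1 tn1 eq_sym tn0.
  have [h1 h2] := ext pp pm t ppE pmE t01 tE.
  by move: neq; rewrite h1 h2 eqxx.
case=> ->; split=> // phi1 phi2 t phi1E phi2E /andP[t0 t1] E;
  have [t1' /andP[h1 h1'] E1] := coord phi1 phi1E;
  have [t2' /andP[h2 h2'] E2] := coord phi2 phi2E;
  have := E 1; rewrite E1 E2 => F.
(* A proper convex combination of numbers in [[0, 1]] is 1 only if both are 1; the other endpoint is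
   the same with 0. *)
- have G : t * t1' + (1 - t) * t2' = 1.
    by apply: (mulIf D); lra.
  have [e1 e2] : t1' = 1 /\ t2' = 1 by split; nra.
  by split; apply/funext => k; rewrite ?E1 ?E2 ?e1 ?e2; lra.
- have G : t * t1' + (1 - t) * t2' = 0.
    by apply: (mulIf D); lra.
  have [e1 e2] : t1' = 0 /\ t2' = 0 by split; nra.
  by split; apply/funext => k; rewrite ?E1 ?E2 ?e1 ?e2; lra.
Qed.

End Extremal.

Theorem theorem2p9 (R : realType) (M : R) (w : int -> R) (p q : int)
    (M_gt0 : 0 < M) (w_env : loop_environment w) (w_nice : nice M w) :
  let lambda := spectral_radius w p q in
  [/\ extremal_points (normalized_positive_eigenvectors w lambda)
        = [set psi_plus w lambda; psi_minus w lambda],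
      psi_plus w lambda <> psi_minus w lambda,
      (forall i j : int, i <= j -> psi_plus w lambda i <= psi_plus w lambda j)
    & (forall i j : int, i <= j -> psi_minus w lambda j <= psi_minus w lambda i)].
Proof.
rewrite (nice_spectral_radius p q M_gt0 w_nice) /=.
have [w_bnd wM _] := w_nice.
have w'_bnd i : 0 <= w (- i) <= M by exact: w_bnd.
have ppE := psi_plus_eigenvector M_gt0 w_bnd.
have pp_homo := psi_plus_homo M_gt0 w_bnd.
have pm_homo i j : i <= j -> psi_minus w (M + 2) j <= psi_minus w (M + 2) i.
  by move=> ij; rewrite !psi_minus_reflect psi_plus_homo // lerN2.
have pmE : normalized_positive_eigenvectors w (M + 2) (psi_minus w (M + 2)).
  (* Reflecting the eigenvector of the reflected environment leads back to [w]. *)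
  have := eigenvector_reflect (psi_plus_eigenvector M_gt0 w'_bnd).
  rewrite (_ : (fun k => w (- - k)) = w); last by apply/funext => k; rewrite opprK.
  rewrite (_ : (fun k => psi_plus _ _ (- k)) = psi_minus w (M + 2)) //.
  by apply/funext => k; rewrite psi_minus_reflect.
split=> //; first exact: extremal_points_monotone.
move=> E; have := monotone_pair_neq wM ppE pmE pp_homo pm_homo.
by rewrite E eqxx.
Qed.
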